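(* If $a,b\in\mathbf{F}(\mathbb{Z})$ are elements with (finite) periodicities $n$ and $m$, respectively, then the subalgebra of $\mathbf{F}(\mathbb{Z})$ generated by $\{a,b\}$ contains an element of periodicity $\mathrm{lcm}\{n,m\}$.
   Context: $\mathbf{F}(\mathbb{Z})$ is the algebra $(F(\mathbb{Z}),\wedge,\vee,\circ,\mathrm{id},{}^\ell,{}^r)$ of all order-preserving maps $f\colon\mathbb{Z}\to\mathbb{Z}$ such that $f^{-1}[\{x\}]$ is finite for every $x\in\mathbb{Z}$, with composition, the identity map, pointwise lattice operations, and $f^{\ell}(q)=\min\{p: q\le f(p)\}$, $f^{r}(q)=\max\{p: f(p)\le q\}$ (it is an $\ell$-pregroup). Write $f^{\ell^k}$, $f^{r^k}$ for the $k$-fold application of ${}^\ell$, ${}^r$. An element $f$ is $k$-periodic if $f^{\ell^k}=f^{r^k}$; equivalently, $f(x+k)=f(x)+k$ for all $x\in\mathbb{Z}$. The periodicity of $f$ is the least $k\ge 1$ such that $f$ is $k$-periodic, if one exists. Subalgebras are with respect to the signature $(\wedge,\vee,\cdot,1,{}^\ell,{}^r)$. *)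

(* Defs.v *)
From mathcomp Require Import all_boot all_order all_algebra zify.
From mathcomp Require Import boolp classical_sets functions cardinality.

Set Implicit Arguments.
Unset Strict Implicit.
Unset Printing Implicit Defensive.

Import Order.TTheory GRing.Theory Num.Theory.
Local Open Scope classical_set_scope.
Local Open Scope ring_scope.

Record FZ := MkFZ {
  FZ_fun :> int -> int;
  FZ_homo : {homo FZ_fun : x y / x <= y};
  FZ_fiber : forall x : int, finite_set (FZ_fun @^-1` [set x])
}.

Lemma FZ_ext (f g : FZ) : f =1 g -> f = g.
Proof.
case: f g => [f f1 f2] [g g1 g2] /= /funext fg; rewrite {}fg in f1 f2 *.
by rewrite (Prop_irrelevance f1 g1) (Prop_irrelevance f2 g2).
Qed.

Definition is_min (P : set int) (p : int) := P p /\ forall p', P p' -> p <= p'.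
Definition is_max (P : set int) (p : int) := P p /\ forall p', P p' -> p' <= p.

Lemma finite_int_bound (A : set int) :
  finite_set A -> exists M : nat, forall x, A x -> `|x| <= M%:Z.
Proof.
case/finite_seqP => s ->; elim: s => [|a s [M HM]]; first by exists 0%N.
exists (maxn `|a|%N M) => x /=; rewrite inE => /orP[/eqP ->|/HM]; lia.
Qed.

Lemma bound_int_finite (a b : int) (A : set int) :
  (forall x, A x -> a <= x <= b) -> finite_set A.
Proof.
move=> H; apply: (@sub_finite_set _ _ [set a + n%:Z | n in `I_(`|(b - a)%R|.+1)]).
  move=> x /H xab; exists `|(x - a)%R|%N => /=; lia.
exact/finite_image/finite_II.
Qed.

Lemma FZ_ge (f : FZ) (q : int) : exists p, q <= f p.
Proof.
suff H (n : nat) : exists p, f 0 + n%:Z <= f p.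
  by have [p Hp] := H `|(q - f 0)%R|%N; exists p; lia.
elim: n => [|n [p Hp]]; first by exists (0 : int); lia.
have [M HM] := finite_int_bound (FZ_fiber f (f p)).
have le1 : p <= `|p| + M%:Z + 1 by lia.
have := FZ_homo f le1; set p' := (_ + 1) => le2.
exists p'; have : f p' <> f p by move/HM; rewrite /p'; lia.
lia.
Qed.

Lemma FZ_le (f : FZ) (q : int) : exists p, f p <= q.
Proof.
suff H (n : nat) : exists p, f p <= f 0 - n%:Z.
  by have [p Hp] := H `|(q - f 0)%R|%N; exists p; lia.
elim: n => [|n [p Hp]]; first by exists (0 : int); lia.
have [M HM] := finite_int_bound (FZ_fiber f (f p)).
have le1 : - (`|p| + M%:Z + 1) <= p by lia.
have := FZ_homo f le1; set p' := - _ => le2.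
exists p'; have : f p' <> f p by move/HM; rewrite /p'; lia.
lia.
Qed.

Lemma ex_min (P : set int) (a b : int) :
  P b -> (forall p, P p -> a <= p) -> exists p, is_min P p.
Proof.
move=> Pb Pa; have exP : exists n : nat, `[< P (a + n%:Z) >].
  exists `|(b - a)%R|%N; apply/asboolP; suff -> : a + `|(b - a)%R|%N%:Z = b by [].
  by have := Pa _ Pb; lia.
case: (ex_minnP exP) => n /asboolP Pn nmin; exists (a + n%:Z); split=> // p Pp.
have ap := Pa _ Pp; have : (n <= `|(p - a)%R|)%N.
  by apply/nmin/asboolP; suff -> : a + `|(p - a)%R|%N%:Z = p by []; lia.
lia.
Qed.

Lemma ex_max (P : set int) (a b : int) :
  P b -> (forall p, P p -> p <= a) -> exists p, is_max P p.
Proof.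
move=> Pb Pa; have [||p [Pp pmin]] := @ex_min [set p | P (- p)] (- a) (- b).
- by rewrite /= opprK.
- by move=> p /Pa; lia.
- exists (- p); split=> // p' Pp'.
  by have := pmin (- p'); rewrite /= opprK => /(_ Pp'); lia.
Qed.

(* The default value 0 of xget is never used: see lres_funP and rres_funP. *)
Definition lres_fun (f : FZ) (q : int) : int := xget 0 (is_min [set p | q <= f p]).
Definition rres_fun (f : FZ) (q : int) : int := xget 0 (is_max [set p | f p <= q]).

Lemma lres_funP (f : FZ) (q : int) : is_min [set p | q <= f p] (lres_fun f q).
Proof.
apply: xgetPex; have [b qb] := FZ_ge f q; have [a aq] := FZ_le f (q - 1).
apply: (@ex_min _ a b) => // p /= qp; rewrite leNgt; apply/negP => pa.
by have := FZ_homo f (ltW pa); lia.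
Qed.

Lemma rres_funP (f : FZ) (q : int) : is_max [set p | f p <= q] (rres_fun f q).
Proof.
apply: xgetPex; have [b qb] := FZ_le f q; have [a aq] := FZ_ge f (q + 1).
apply: (@ex_max _ a b) => // p /= qp; rewrite leNgt; apply/negP => pa.
by have := FZ_homo f (ltW pa); lia.
Qed.

Lemma lres_homo (f : FZ) : {homo lres_fun f : x y / x <= y}.
Proof.
move=> x y xy; have [_ +] := lres_funP f x; apply=> /=.
by have [/= + _] := lres_funP f y; apply: le_trans.
Qed.

Lemma rres_homo (f : FZ) : {homo rres_fun f : x y / x <= y}.
Proof.
move=> x y xy; have [_ +] := rres_funP f y; apply=> /=.
by have [/= + _] := rres_funP f x; move=> /le_trans; apply.
Qed.

Lemma lres_fiber (f : FZ) (x : int) : finite_set (lres_fun f @^-1` [set x]).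
Proof.
apply: (@bound_int_finite (f (x - 1)) (f x)) => q /= <-.
have [/= H1 H2] := lres_funP f q; rewrite H1 andbT leNgt.
by apply/negP => /ltW /H2; lia.
Qed.

Lemma rres_fiber (f : FZ) (x : int) : finite_set (rres_fun f @^-1` [set x]).
Proof.
apply: (@bound_int_finite (f x) (f (x + 1))) => q /= <-.
have [/= H1 H2] := rres_funP f q; rewrite H1 /= leNgt.
by apply/negP => /ltW /H2; lia.
Qed.

Lemma id_fiber (x : int) : finite_set ((@id int) @^-1` [set x]).
Proof. exact: finite_set1. Qed.

Lemma comp_homo (f g : FZ) : {homo f \o g : x y / x <= y}.
Proof. by move=> x y /(FZ_homo g) /(FZ_homo f). Qed.

Lemma comp_fiber (f g : FZ) (x : int) : finite_set ((f \o g) @^-1` [set x]).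
Proof.
apply: (@sub_finite_set _ _ (\bigcup_(y in f @^-1` [set x]) (g @^-1` [set y]))).
  by move=> z /= fgz; exists (g z).
by apply: bigcup_finite => [|y _]; apply: FZ_fiber.
Qed.

Lemma min_homo (f g : FZ) : {homo f \min g : x y / x <= y}.
Proof. by move=> x y xy /=; have := FZ_homo f xy; have := FZ_homo g xy; lia. Qed.

Lemma max_homo (f g : FZ) : {homo f \max g : x y / x <= y}.
Proof. by move=> x y xy /=; have := FZ_homo f xy; have := FZ_homo g xy; lia. Qed.

Lemma min_fiber (f g : FZ) (x : int) : finite_set ((f \min g) @^-1` [set x]).
Proof.
apply: (@sub_finite_set _ _ (f @^-1` [set x] `|` g @^-1` [set x])).
  by move=> z /=; lia.
by rewrite finite_setU; split; apply: FZ_fiber.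
Qed.

Lemma max_fiber (f g : FZ) (x : int) : finite_set ((f \max g) @^-1` [set x]).
Proof.
apply: (@sub_finite_set _ _ (f @^-1` [set x] `|` g @^-1` [set x])).
  by move=> z /=; lia.
by rewrite finite_setU; split; apply: FZ_fiber.
Qed.

Definition meetF (f g : FZ) : FZ := MkFZ (@min_homo f g) (min_fiber f g).
Definition joinF (f g : FZ) : FZ := MkFZ (@max_homo f g) (max_fiber f g).
Definition compF (f g : FZ) : FZ := MkFZ (@comp_homo f g) (comp_fiber f g).
Definition idF : FZ := MkFZ (fun x y (xy : x <= y) => xy) id_fiber.
Definition lresF (f : FZ) : FZ := MkFZ (@lres_homo f) (lres_fiber f).
Definition rresF (f : FZ) : FZ := MkFZ (@rres_homo f) (rres_fiber f).

Definition subalgebra (S : set FZ) : Prop :=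
  [/\ S idF,
      forall f g, S f -> S g -> S (meetF f g),
      forall f g, S f -> S g -> S (joinF f g),
      forall f g, S f -> S g -> S (compF f g)
    & forall f, S f -> S (lresF f) /\ S (rresF f)].

Definition generated (X : set FZ) : set FZ := smallest subalgebra X.

(* Equality of the k-fold residuals as elements of F(Z); every f is trivially
   0-periodic, so has_periodicity only considers k > 0. *)
Definition periodic (k : nat) (f : FZ) : Prop :=
  iter k lresF f = iter k rresF f.

Definition has_periodicity (f : FZ) (n : nat) : Prop :=
  [/\ (0 < n)%N, periodic n f
    & forall k : nat, (0 < k)%N -> periodic k f -> (n <= k)%N].

(* Main.v *)
Require Import Defs.
From mathcomp Require Import all_boot all_order all_algebra.
From mathcomp Require Import boolp classical_sets.
From mathcomp Require Import zify.

Import Order.TTheory GRing.Theory Num.Theory.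

Local Open Scope ring_scope.
Local Open Scope classical_set_scope.

(** For [1 < n] let [T_n] be the map [x |-> x + 1] on the multiples of [n] and
    [x |-> x] elsewhere.  Its periodicity is [n], and the pointwise minimum of
    [T_n] and [T_m] is [T_(lcm n m)].  Since an element of periodicity 1 leaves
    nothing to prove (the other generator has the right periodicity), it is
    enough that every subalgebra containing an element [f] of periodicity
    [n > 1] contains [T_n] ([bump_in_subalgebra]).

    The subalgebra contains the closure operators [f f^l] and [f^l f^ll], whose
    fixed points are the image of [f] and the image of [f^l], the latter being
    the set of points at which [f] jumps.  It is closed under finite meets and,
    because [f^ll x = f (x - 1) + 1], under conjugation by translations.  Now
    suppose that for some [0 < d < n] every [n]-periodic extensive map of the
    subalgebra that moves 0 also moves [d].  Applied to the conjugates of the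
    two closure operators, this says that the sets of their non-fixed points
    are stable under adding [d], so, being [n]-periodic, invariant under
    translation by [d].  But an [n]-periodic [f] is determined by its image and
    its jumps rigidly enough that [f (x + d) = f x + d] follows
    ([step_rigidity]), contradicting the minimality of [n].  Hence each
    [0 < d < n] is fixed by some such map moving 0 ([separation]), and the meet
    of these maps is [T_n]. *)

(** * Residuals, periodicity and conjugation *)

Lemma lresF_adj (f : FZ) (q p : int) : (lresF f q <= p) = (q <= f p).
Proof.
have [/= qf qmin] := lres_funP f q.
apply/idP/idP => [/(FZ_homo f)|/qmin //]; exact: le_trans.
Qed.

Lemma rresF_adj (f : FZ) (q p : int) : (p <= rresF f q) = (f p <= q).
Proof.
have [/= fq qmax] := rres_funP f q.
apply/idP/idP => [/(FZ_homo f) /le_trans|/qmax //]; exact.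
Qed.

(** An element of [F(Z)] is determined by the principal down-sets of its
    values, which is what the two adjunctions describe. *)
Lemma FZ_ext_le (f g : FZ) :
  (forall x p, (f x <= p) = (g x <= p)) -> f = g.
Proof.
move=> fg; apply: FZ_ext => x.
by have := fg x (f x); have := fg x (g x); rewrite !lexx; lia.
Qed.

Lemma lresF_rresF : cancel rresF lresF.
Proof. by move=> f; apply: FZ_ext_le => x p; rewrite lresF_adj rresF_adj. Qed.

Lemma rresF_lresF : cancel lresF rresF.
Proof.
move=> f; apply: FZ_ext => x; apply/eqP; rewrite eq_le.
by rewrite rresF_adj lresF_adj lexx -lresF_adj -rresF_adj lexx.
Qed.

(** Over the integers [x <= f^l q] is the negation of [q <= f (x - 1)], which
    turns the double residual into conjugation by the unit translation. *)
Lemma lresF2E (f : FZ) (x : int) : lresF (lresF f) x = f (x - 1) + 1.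
Proof.
have H p : (lresF (lresF f) x <= p) = (f (x - 1) + 1 <= p).
  by rewrite lresF_adj; have := lresF_adj f p (x - 1); lia.
by have := H (lresF (lresF f) x); have := H (f (x - 1) + 1); rewrite !lexx; lia.
Qed.

Lemma rresF2E (f : FZ) (x : int) : rresF (rresF f) x = f (x + 1) - 1.
Proof.
have := lresF2E (rresF (rresF f)) (x + 1).
by rewrite !lresF_rresF addrK => ->; rewrite addrK.
Qed.

Lemma iter_lresF2E (k : nat) (f : FZ) (x : int) :
  iter k (fun g => lresF (lresF g)) f x = f (x - k%:Z) + k%:Z.
Proof.
elim: k x => [|k IH] x; first by rewrite /= subr0 addr0.
rewrite iterS lresF2E IH (_ : x - 1 - k%:Z = x - k.+1%:Z); lia.
Qed.

Lemma iter_rresF2E (k : nat) (f : FZ) (x : int) :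
  iter k (fun g => rresF (rresF g)) f x = f (x + k%:Z) - k%:Z.
Proof.
elim: k x => [|k IH] x; first by rewrite /= subr0 addr0.
rewrite iterS rresF2E IH (_ : x + 1 + k%:Z = x + k.+1%:Z); lia.
Qed.

Definition translates (d : int) (f : int -> int) :=
  forall x, f (x + d) = f x + d.

(** As [l] and [r] are mutually inverse, [k]-periodicity says that [2k]-fold
    [l] fixes [f], that is, that conjugation by translation by [k] does. *)
Lemma periodicE (k : nat) (f : FZ) : periodic k f <-> translates k%:Z f.
Proof.
have iter2 g : iter k (fun g => lresF (lresF g)) g = iter k lresF (iter k lresF g).
  rewrite -iterD; elim: (k) => // j IH.
  by rewrite addSn addnS !iterS IH.
have iterK : cancel (iter k rresF) (iter k lresF).
  by elim: (k) => // j IH g; rewrite iterSr [iter j.+1 rresF g]/= lresF_rresF.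
have iterK' : cancel (iter k lresF) (iter k rresF).
  by elim: (k) => // j IH g; rewrite iterSr [iter j.+1 lresF g]/= rresF_lresF.
split=> [per x | tr].
  have := iter_lresF2E k f (x + k%:Z).
  by rewrite iter2 per iterK addrK.
rewrite /periodic -[in RHS](_ : iter k lresF (iter k lresF f) = f) ?iterK' //.
rewrite -iter2; apply: FZ_ext => x.
by rewrite iter_lresF2E -tr subrK.
Qed.

Lemma translatesMn (d : int) (f : int -> int) (k : nat) :
  translates d f -> translates (d * k%:Z) f.
Proof.
move=> tr; elim: k => [|k IH] x; first by rewrite mulr0 !addr0.
by rewrite (_ : d * k.+1%:Z = d * k%:Z + d) ?addrA ?tr ?IH; lia.
Qed.

Lemma translatesN (d : int) (f : int -> int) :
  translates d f -> translates (- d) f.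
Proof. by move=> tr x; have := tr (x - d); rewrite subrK; lia. Qed.

Lemma translatesM (d : int) (f : int -> int) (k : int) :
  translates d f -> translates (d * k) f.
Proof.
move=> tr; case: (intP k) => [|j|j]; [exact: (translatesMn _ _ 0)|exact: translatesMn|].
by rewrite mulrN; apply/translatesN/translatesMn.
Qed.

Lemma translates_lresF (d : int) (f : FZ) :
  translates d f -> translates d (lresF f).
Proof.
move=> /translatesN tr x.
have H p : (lresF f (x + d) <= p) = (lresF f x + d <= p).
  rewrite lresF_adj; have := lresF_adj f x (p - d); rewrite tr; lia.
by have := H (lresF f (x + d)); have := H (lresF f x + d); rewrite !lexx; lia.
Qed.

Lemma subalgebra_conj (S : set FZ) (f : FZ) (u : int) :
  subalgebra S -> S f -> exists2 g : FZ, S g & forall x, g x = f (x + u) - u.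
Proof.
case=> _ _ _ _ res Sf; case: (intP u) => [|k|k].
- by exists f => // x; rewrite addr0 subr0.
- exists (iter k.+1 (fun g => rresF (rresF g)) f); last exact: iter_rresF2E.
  by elim: k.+1 => // j IH; apply: (res _ _).2; apply: (res _ _).2.
- exists (iter k.+1 (fun g => lresF (lresF g)) f).
    by elim: k.+1 => // j IH; apply: (res _ _).1; apply: (res _ _).1.
  by move=> x; rewrite iter_lresF2E opprK.
Qed.

(** * The closure operator of an image *)

Definition closure_op (f : FZ) : FZ := compF f (lresF f).

Lemma closure_op_ge (f : FZ) (x : int) : x <= closure_op f x.
Proof. by rewrite /= -lresF_adj. Qed.

Lemma closure_op_fixed (f : FZ) (x : int) :
  closure_op f x = x <-> exists p, f p = x.
Proof.
split=> [<-|[p fp]]; first by exists (lresF f x).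
apply/eqP; rewrite eq_le closure_op_ge andbT -[in leRHS]fp.
by apply: (FZ_homo f); rewrite lresF_adj fp.
Qed.

Lemma translates_closure_op (d : int) (f : FZ) :
  translates d f -> translates d (closure_op f).
Proof.
by move=> tr x; have /= -> := translates_lresF _ _ tr x; apply: tr.
Qed.

Lemma lresF_image (f : FZ) (y : int) :
  (exists q, lresF f q = y) <-> f (y - 1) < f y.
Proof.
split=> [[q qy] | jump].
  by have := lresF_adj f q y; have := lresF_adj f q (y - 1); rewrite qy; lia.
exists (f y); have := lresF_adj f (f y) y; have := lresF_adj f (f y) (y - 1).
lia.
Qed.

(** * Rigidity of periodic step functions *)

(** At a jump [f] moves to the next point of its image, which is at most the
    value [g y]: that value lies in the image of [f] and exceeds [f y].  As [g]
    jumps there too, the strict inequality survives. *)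
Lemma lt_propagates (f g : FZ) :
    (forall y, exists z, f z = g y) ->
    (forall y, f (y - 1) < f y -> g (y - 1) < g y) ->
  forall y (k : nat), f y < g y -> f (y + k%:Z) < g (y + k%:Z).
Proof.
move=> img jump y k fg; elim: k => [|k IH]; first by rewrite addr0.
have := jump (y + k.+1%:Z); rewrite (_ : y + k.+1%:Z - 1 = y + k%:Z); last lia.
have kk1 : y + k%:Z <= y + k.+1%:Z by lia.
have := FZ_homo f kk1; have := FZ_homo g kk1.
have [z fz] := img (y + k%:Z).
have [zle|zgt] := leP z (y + k%:Z); first by have := FZ_homo f zle; lia.
have {}zgt : y + k.+1%:Z <= z by lia.
have := FZ_homo f zgt; lia.
Qed.

(** Iterating a strict inequality between [f x] and [f (x + d) - d] along the
    points [y + j d] gives one between [f y] and [f (y + n d) - n d], which are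
    equal by [n]-periodicity. *)
Lemma no_strict_drift (f : FZ) (n d : nat) (y : int) :
  (0 < n)%N -> translates n%:Z f ->
  ~ (forall k : nat, f (y + k%:Z) < f (y + k%:Z + d%:Z) - d%:Z) /\
  ~ (forall k : nat, f (y + k%:Z + d%:Z) - d%:Z < f (y + k%:Z)).
Proof.
move=> n0 /translatesMn tr.
have E (j : nat) : y + (d * j)%N%:Z + d%:Z = y + (d * j.+1)%N%:Z by lia.
have per : f (y + (d * n)%N%:Z) = f y + (d * n)%N%:Z.
  by rewrite (_ : (d * n)%N%:Z = n%:Z * d%:Z) ?tr //; lia.
have y0 : y + (d * 0)%N%:Z = y by lia.
split=> drift.
- suff H (j : nat) : f y + (d * j)%N%:Z + j%:Z <= f (y + (d * j)%N%:Z).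
    by have := H n; lia.
  elim: j => [|j IH]; first by rewrite y0; lia.
  by have := drift (d * j)%N; rewrite E; lia.
- suff H (j : nat) : f (y + (d * j)%N%:Z) + j%:Z <= f y + (d * j)%N%:Z.
    by have := H n; lia.
  elim: j => [|j IH]; first by rewrite y0; lia.
  by have := drift (d * j)%N; rewrite E; lia.
Qed.

(** A set that is invariant under translation by [n > 0] and stable under
    adding [d] is also stable under subtracting [d], because [- d] is
    [(n - 1) d] modulo [n]. *)
Lemma periodic_stableN (U : int -> Prop) (n d : nat) :
    (0 < n)%N -> (forall x (k : int), U x -> U (x + n%:Z * k)) ->
    (forall x, U x -> U (x + d%:Z)) ->
  forall x, U x -> U (x - d%:Z).
Proof.
case: n => // n _ per stab x Ux.
have H (k : nat) : U (x + (d * k)%N%:Z).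
  elim: k => [|k IH]; first by rewrite muln0 addr0.
  by rewrite (_ : x + _ = x + (d * k)%N%:Z + d%:Z); [exact: stab | lia].
have := per _ (- d%:Z) (H n).
rewrite (_ : x + _ + _ = x - d%:Z) //.
by rewrite PoszM -addn1 PoszD mulrN mulrDl mul1r [n%:Z * _]mulrC; lia.
Qed.

Definition moved (f : FZ) (x : int) := f x <> x.

(** The conjugate [g x = f (x + d) - d] has the same image and the same jumps as
    [f].  Two such maps can still differ, by shifting along the image, but then
    one lies strictly below the other from some point on, and this drift
    contradicts [n]-periodicity. *)
Lemma step_rigidity (f : FZ) (n d : nat) :
    (0 < n)%N -> translates n%:Z f ->
    (forall x, moved (closure_op f) x -> moved (closure_op f) (x + d%:Z)) ->
    (forall x, moved (closure_op (lresF f)) x ->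
               moved (closure_op (lresF f)) (x + d%:Z)) ->
  translates d%:Z f.
Proof.
move=> n0 tr stA stB.
have per (h : FZ) : translates n%:Z h ->
    forall x (k : int), moved h x -> moved h (x + n%:Z * k).
  by by move=> trh x k mx; rewrite /moved translatesM // => /addIr.
have stA' := periodic_stableN _ _ _ n0 (per _ (translates_closure_op _ _ tr)) stA.
have stB' := periodic_stableN _ _ _ n0
  (per _ (translates_closure_op _ _ (translates_lresF _ _ tr))) stB.
have fixA x : ~ moved (closure_op f) x <-> exists p, f p = x.
  by rewrite -closure_op_fixed /moved; split=> [/contrapT|? []].
have fixB x : ~ moved (closure_op (lresF f)) x <-> f (x - 1) < f x.
  by rewrite -lresF_image -closure_op_fixed /moved; split=> [/contrapT|? []].
have [g _ gE] : exists2 g : FZ, setT g & forall x, g x = f (x + d%:Z) - d%:Z.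
  by apply: subalgebra_conj.
have shift y : y - 1 + d%:Z = y + d%:Z - 1 by lia.
have img1 y : exists z, f z = g y.
  apply/fixA => /stA; rewrite gE subrK; apply/fixA; by exists (y + d%:Z).
have img2 y : exists z, g z = f y.
  have [z fz] : exists z, f z = f y + d%:Z.
    by apply/fixA => /stA'; rewrite addrK; apply/fixA; exists y.
  by exists (z - d%:Z); rewrite gE subrK fz addrK.
have jump1 y : f (y - 1) < f y -> g (y - 1) < g y.
  move=> /fixB Hy; rewrite !gE ltrD2r shift; apply/fixB => /stB'.
  by rewrite addrK.
have jump2 y : g (y - 1) < g y -> f (y - 1) < f y.
  by rewrite !gE ltrD2r shift => /fixB Hy; apply/fixB => /stB.
move=> y; have [no1 no2] := no_strict_drift f n d y n0 tr.
have := gE y; have [lt|gt|] := ltgtP (f y) (g y); last lia.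
- by case: no1 => k; rewrite -gE; apply: lt_propagates.
- by case: no2 => k; rewrite -gE; apply: lt_propagates.
Qed.

(** * Bump functions in a subalgebra *)

(** A pointwise minimum of such maps is again such a map and fixes every point
    that one of them fixes, so points can be eliminated one at a time. *)
Definition moves0 (S : set FZ) (n : nat) (g : FZ) :=
  [/\ S g, translates n%:Z g, forall x, x <= g x & 0 < g 0].

(** Otherwise [d] is moved by all maps of [moves0 S n], in particular by the
    suitable conjugates of the closure operators of [f] and [f^l]; their sets of
    moved points are then stable under adding [d], and [f] is [d]-periodic by
    [step_rigidity]. *)
Lemma separation (S : set FZ) (f : FZ) (n d : nat) :
    subalgebra S -> S f -> has_periodicity f n -> (0 < d < n)%N ->
  exists2 g, moves0 S n g & g d%:Z = d%:Z.
Proof.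
move=> algS Sf [n0 /periodicE tr minn] /andP[d0 dn]; apply: contrapT => nosep.
suff /periodicE /(minn _ d0) : translates d%:Z f by rewrite leqNgt dn.
have [_ _ _ cmp res] := algS.
(* conjugating by the moved point [u] carries it to 0, so [d + u] is moved *)
have stab h : S h -> translates n%:Z h ->
    forall u, moved (closure_op h) u -> moved (closure_op h) (u + d%:Z).
  move=> Sh trh u mu fixd; apply: nosep.
  have Sc : S (closure_op h) by apply: cmp => //; apply: (res _ Sh).1.
  have [g Sg gE] := subalgebra_conj _ _ u algS Sc.
  exists g; last by rewrite gE [d%:Z + u]addrC fixd addrAC subrr add0r.
  split=> // [x|x|].
  - by rewrite !gE [x + _ + u]addrAC (translates_closure_op _ _ trh) addrAC.
  - by rewrite gE; have := closure_op_ge h (x + u); lia.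
  - rewrite gE add0r; have := closure_op_ge h u; move: mu; rewrite /moved; lia.
apply: (step_rigidity f n d n0 tr); apply: stab => //.
  exact: (res _ Sf).1.
exact: translates_lresF.
Qed.

Definition is_bump (n : nat) (g : FZ) :=
  forall x, g x = if (n %| x)%Z then x + 1 else x.

(** Once [g] fixes [1, ..., n - 1], its value at 0 is squeezed between [0 < g 0]
    and [g 0 <= g 1 = 1], and periodicity gives the remaining values. *)
Lemma bump_in_subalgebra (S : set FZ) (f : FZ) (n : nat) :
    subalgebra S -> S f -> has_periodicity f n -> (1 < n)%N ->
  exists2 g, S g & is_bump n g.
Proof.
move=> algS Sf perf n1.
have [g [Sg tr ge g0] fixd] : exists2 g, moves0 S n g &
    forall d : nat, (0 < d < n)%N -> g d%:Z = d%:Z.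
  suff /(_ n) [g mg fixd] : forall k : nat, exists2 g, moves0 S n g &
      forall d : nat, (0 < d < n)%N -> (d < k)%N -> g d%:Z = d%:Z.
    by exists g => // d dn; apply: fixd => //; case/andP: dn.
  (* for [k = 0], separating any point, here 1, provides a first map moving 0 *)
  elim => [|k [g [Sg tr ge g0] fixg]].
    by have [//|g mg _] := separation S f n 1 algS Sf perf; exists g.
  have [kn|kn] := boolP (0 < k < n)%N; last first.
    by exists g => // d dn dk; apply: fixg => //; lia.
  have [h [Sh trh geh h0] fixh] := separation S f n k algS Sf perf kn.
  exists (meetF g h).
    split=> [|x|x|] /=; first by case: algS => _ meet _ _ _; apply: meet.
    - by rewrite tr trh; lia.
    - by have := ge x; have := geh x; lia.
    - by lia.
  move=> d dn dk /=; have := ge d%:Z; have := geh d%:Z.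
  have [->|ndk] := eqVneq d k; first by rewrite fixh; lia.
  by rewrite fixg //; lia.
have g0E : g 0 = 1.
  have : g 0 <= g 1 by apply: (FZ_homo g).
  by rewrite (fixd 1%N) ?n1 //; lia.
exists g => // x.
rewrite [in LHS](divz_eq x n%:Z) [in LHS]addrC [in LHS]mulrC translatesM //.
have n0' : n%:Z != 0 by lia.
have := modz_ge0 x n0'; have := ltz_pmod x (_ : 0 < n%:Z).
have := divz_eq x n%:Z.
rewrite dvdz_eq; have [e|ne] := eqVneq (x %% n%:Z)%Z 0.
  by rewrite e g0E; case: eqP; lia.
move=> xE lt ge0; have -> : g (x %% n%:Z)%Z = (x %% n%:Z)%Z.
  have := fixd `|(x %% n%:Z)%Z|%N; rewrite gez0_abs //; apply; lia.
by case: eqP; lia.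
Qed.

Lemma bump_periodicity (n : nat) (g : FZ) :
  (0 < n)%N -> is_bump n g -> has_periodicity g n.
Proof.
move=> n0 gE; split=> // [|k k0 /periodicE /(_ 0)].
  by apply/periodicE => x; rewrite !gE [in LHS]rpredDr ?dvdzz //; case: ifP => // _; rewrite addrAC.
rewrite add0r !gE dvdz0 add0r; case: ifP => [nk _|_]; last lia.
exact: dvdn_leq.
Qed.

Lemma bump_meet (n m : nat) (g h : FZ) :
  is_bump n g -> is_bump m h -> is_bump (lcmn n m) (meetF g h).
Proof.
move=> gE hE x /=; rewrite gE hE.
have -> : (lcmn n m %| x)%Z = (n %| x)%Z && (m %| x)%Z by rewrite !dvdzE dvdn_lcm.
by case: (n %| x)%Z; case: (m %| x)%Z => /=; lia.
Qed.

Theorem corollary3p20 (a b : FZ) (n m : nat)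
    (ha : has_periodicity a n) (hb : has_periodicity b m) :
  exists2 c : FZ, generated [set a; b] c & has_periodicity c (lcmn n m).
Proof.
have Ga : generated [set a; b] a by move=> S [_]; apply; left.
have Gb : generated [set a; b] b by move=> S [_]; apply; right.
have algG : subalgebra (generated [set a; b]).
  split=> [S [[]]//|f g Gf Gg S HS|f g Gf Gg S HS|f g Gf Gg S HS|f Gf].
  - by case: (HS) => -[_ H _ _ _] _; apply: H; [apply: Gf|apply: Gg].
  - by case: (HS) => -[_ _ H _ _] _; apply: H; [apply: Gf|apply: Gg].
  - by case: (HS) => -[_ _ _ H _] _; apply: H; [apply: Gf|apply: Gg].
  - by split=> S HS; case: (HS) => -[_ _ _ _ H] _; have [] := H f (Gf S HS).
have n0 : (0 < n)%N by case: ha.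
have m0 : (0 < m)%N by case: hb.
have [n1|n1] := leqP n 1; first by exists b => //; rewrite (_ : n = 1%N) ?lcm1n //; lia.
have [m1|m1] := leqP m 1; first by exists a => //; rewrite (_ : m = 1%N) ?lcmn1 //; lia.
have [g Gg bg] := bump_in_subalgebra _ a n algG Ga ha n1.
have [h Gh bh] := bump_in_subalgebra _ b m algG Gb hb m1.
exists (meetF g h); first by case: algG => _ meet _ _ _; apply: meet.
by apply: bump_periodicity; [rewrite lcmn_gt0 n0 m0|apply: bump_meet].
Qed.
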